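(* Let $\alpha\in\mathbb{T}$ not be a root of unity. For every strictly increasing sequence $(n_k)_{k\ge1}$ of positive integers, there is a dense $G_\delta$ set $\mathcal{B}$ in the space of mean-zero functions in $C(\mathbb{T})$ (with the uniform norm) such that for any $f\in\mathcal{B}$, the series $\sum_{k=1}^\infty M_{n_k}^\alpha f$ is not unconditionally convergent in $C(\mathbb{T})$.
   Context: $\mathbb{T}=\{z\in\mathbb{C}:|z|=1\}$, and $C(\mathbb{T})$ is the space of continuous functions on $\mathbb{T}$ with the uniform norm. A function $f$ is mean-zero if its integral over $\mathbb{T}$ with respect to normalized Lebesgue measure is $0$. For $f\in C(\mathbb{T})$, $M_n^\alpha f(\gamma)=\frac1n\sum_{j=1}^nf(\alpha^j\gamma)$. A series $\sum_{k=1}^\infty f_k$ in a Banach space is unconditionally convergent if $\sum_{k=1}^\infty f_{\pi(k)}$ converges in norm for every permutation $\pi$ of $\{1,2,3,\dots\}$. *)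

(* Defs.v *)
From HB Require Import structures.
From mathcomp Require Import all_boot all_order all_algebra.
From mathcomp Require Import all_classical all_reals all_analysis.
From mathcomp Require Import borel_hierarchy complex.

Set Implicit Arguments.
Unset Strict Implicit.
Unset Printing Implicit Defensive.
Import Order.TTheory GRing.Theory Num.Theory.
Import numFieldNormedType.Exports.
Import ComplexField.Normc.

Local Open Scope classical_set_scope.
Local Open Scope ring_scope.
Local Open Scope complex_scope.

(* The library attaches the topology of the complex numbers to [R[i]^o] only,
   not to [R[i]]. *)
Definition circle (R : realType) : set R[i]^o := [set z | `|z| = 1].
Arguments circle : clear implicits.

Section Circle.
Variable R : realType.
Implicit Types (a z : circle R) (j : nat) (t : R).

Lemma circle_mulX a j z : (val a ^+ j * val z : R[i]^o) \in circle R.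
Proof.
have [a1 z1] := (set_valP a, set_valP z).
by apply/mem_set; rewrite /circle/= normrM normrX a1 z1 expr1n mulr1.
Qed.

Definition rotation a j z : circle R := SigSub (circle_mulX a j z).

Lemma expi_subproof t : (cos t +i* sin t : R[i]^o) \in circle R.
Proof.
apply/mem_set; rewrite /circle/=.
by rewrite -[LHS]/((Num.sqrt (cos t ^+ 2 + sin t ^+ 2))%:C) cos2Dsin2 sqrtr1.
Qed.

Definition expi t : circle R := SigSub (expi_subproof t).

Lemma expi_surj z : exists2 t, t \in `[- pi, pi] & expi t = z.
Proof.
case: z => -[x y] xyP; have := set_mem xyP.
rewrite /circle/= => -[] xy1.
have {}xy1 : x ^+ 2 + y ^+ 2 = 1.
  by rewrite -[LHS]sqr_sqrtr ?xy1 ?expr1n// addr_ge0 ?sqr_ge0.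
have x11 : -1 <= x <= 1.
  rewrite -ler_norml -(@ler_pXn2r _ 2) ?nnegrE//.
  by rewrite expr1n real_normK ?num_real// -xy1 lerDl sqr_ge0.
have yE : 1 - x ^+ 2 = y ^+ 2 by rewrite -xy1 addrC addKr.
have acos_itv : acos x \in `[- pi, pi].
  rewrite in_itv/= (acos_lepi x11) andbT (le_trans _ (acos_ge0 x11))//.
  by rewrite oppr_le0 pi_ge0.
have cosx : cos (acos x) = x by apply: acosK; rewrite in_itv.
have [y0|y0] := leP 0 y.
  exists (acos x) => //; apply: val_inj => /=; congr (_ +i* _) => //.
  by rewrite sin_acos// yE sqrtr_sqr ger0_norm.
exists (- acos x); first by move: acos_itv; rewrite !in_itv/= lerN2 lerNl andbC.
apply: val_inj => /=; congr (_ +i* _); first by rewrite cosN.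
by rewrite sinN sin_acos// yE sqrtr_sqr ltr0_norm// opprK.
Qed.

Lemma normcE (w : R[i]^o) : `|w| = (normc w)%:C.
Proof. by case: w. Qed.

Lemma expi_continuous : continuous expi.
Proof.
apply/continuous_comp_initial => t /=.
apply/cvgrPdist_lt => /= e; case: e => e e' /andP[/= /eqP -> e0].
near=> s.
have -> : (val (expi t) - val (expi s) : R[i]^o) =
  (cos t - cos s)%:C + 'i * (sin t - sin s)%:C :> R[i].
  by apply/eqP; rewrite eq_complex/= !(mul0r,mul1r,mulr0,add0r,addr0,subr0)!eqxx.
rewrite (le_lt_trans (ler_normD _ _))// normrM.
rewrite [`|'i|](_ : _ = 1); last first.
  by rewrite normcE/= expr0n expr1n/= add0r sqrtr1.
rewrite mul1r !normcE -rmorphD ltcR/= expr0n/= !addr0 !sqrtr_sqr.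
rewrite [e]splitr ltrD//; near: s.
- by apply: cvgr_dist_lt; [exact: continuous_cos|rewrite divr_gt0].
- by apply: cvgr_dist_lt; [exact: continuous_sin|rewrite divr_gt0].
Unshelve. all: by end_near. Qed.

Lemma rotation_continuous a j : continuous (rotation a j).
Proof.
apply/continuous_comp_initial => z /=.
apply: (@cvgZl_tmp R[i] R[i]^o _ _ (nbhs_filter z) (val a ^+ j) val).
exact: (@initial_continuous _ _ (@set_val _ (circle R)) z).
Qed.

End Circle.

Definition CT (R : realType) : Type := continuousType (circle R) R[i]^o.

Section ContinuousFunctions.
Variable R : realType.
Implicit Types (f g h : CT R) (a : R).

HB.instance Definition _ := Choice.copy (CT R)
  (continuousType (circle R) R[i]^o).

Lemma CT_ext f g : f =1 g -> f = g.
Proof. by move=> /continuousEP. Qed.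

Lemma CT_continuous f : continuous (f : circle R -> R[i]^o).
Proof. exact: (@cts_fun _ _ f). Qed.

Definition CTof (f : circle R -> R[i]^o) (cf : continuous f) : CT R :=
  mkcts cf.

Lemma CTadd_subproof f g : continuous (fun z => f z + g z).
Proof.
move=> z; apply: (@cvgD R[i] R[i]^o _ _ (nbhs_filter z) f g).
  by have := @CT_continuous f z.
by have := @CT_continuous g z.
Qed.
Definition CTadd f g := CTof (@CTadd_subproof f g).

Lemma CTopp_subproof f : continuous (fun z => - f z).
Proof.
move=> z; apply: (@cvgN R[i] R[i]^o _ _ (nbhs_filter z) f).
by have := @CT_continuous f z.
Qed.
Definition CTopp f := CTof (@CTopp_subproof f).

Lemma CTscale_subproof a f : continuous (fun z => (a%:C : R[i]^o) * f z).
Proof.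
move=> z; apply: (@cvgZl_tmp R[i] R[i]^o _ _ (nbhs_filter z) a%:C f).
exact: CT_continuous.
Qed.
Definition CTscale a f := CTof (@CTscale_subproof a f).

Definition CTzero : CT R := CTof (@cts_fun _ _ (cst (0 : R[i]^o))).

Lemma CTaddA : associative CTadd.
Proof. by move=> f g h; apply: CT_ext => z; exact: addrA. Qed.
Lemma CTaddC : commutative CTadd.
Proof. by move=> f g; apply: CT_ext => z; exact: addrC. Qed.
Lemma CTadd0 : left_id CTzero CTadd.
Proof. by move=> f; apply: CT_ext => z; exact: add0r. Qed.
Lemma CTaddN : left_inverse CTzero CTopp CTadd.
Proof. by move=> f; apply: CT_ext => z; exact: addNr. Qed.

HB.instance Definition _ :=
  GRing.isZmodule.Build (CT R) CTaddA CTaddC CTadd0 CTaddN.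

Lemma CTscaleA a b f : CTscale a (CTscale b f) = CTscale (a * b) f.
Proof.
apply: CT_ext => z; suff : a%:C * (b%:C * f z) = (a * b)%:C * f z by [].
by rewrite rmorphM mulrA.
Qed.
Lemma CTscale1 : left_id 1 CTscale.
Proof. by move=> f; apply: CT_ext => z; exact: mul1r. Qed.
Lemma CTscaleDr : right_distributive CTscale +%R.
Proof. by move=> a f g; apply: CT_ext => z; exact: mulrDr. Qed.
Lemma CTscaleDl f : {morph CTscale^~ f : a b / a + b}.
Proof.
move=> a b; apply: CT_ext => z.
suff : (a + b)%:C * f z = a%:C * f z + b%:C * f z by [].
by rewrite rmorphD mulrDl.
Qed.

(* Scalars are restricted to the reals: this changes neither the norm nor the
   topology, and the norm then takes its values in [R] instead of [R[i]]. *)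
HB.instance Definition _ := GRing.Zmodule_isLmodule.Build R (CT R)
  CTscaleA CTscale1 CTscaleDr CTscaleDl.

Definition sup_norm f : R := sup (range (fun z => normc (f z))).

Lemma CT_bounded f : has_ubound (range (fun z => normc (f z))).
Proof.
have cF : {within `[- pi, pi], continuous (fun t : R => normc (f (expi t)))}.
  apply: continuous_subspaceT => t.
  apply/cvgrPdist_lt => e e0.
  have e0' : (0 : R[i]) < e%:C by rewrite ltcR.
  have ct : (f (expi s) : R[i]^o) @[s --> t] --> (f (expi t) : R[i]^o).
    exact: continuous_comp (@expi_continuous R t) (@CT_continuous f _).
  near=> s.
  have : `|f (expi t) - f (expi s)| < e%:C.
    by near: s; exact: cvgr_dist_lt _ _ ct _ e0'.
  rewrite normcE ltcR; apply: le_lt_trans.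
  exact: (@ler_dist_dist R (Rcomplex R)).
have [|c _ cmax] := EVT_max _ cF.
  by rewrite (@le_trans _ _ 0) ?oppr_le0 ?pi_ge0.
exists (normc (f (expi c))) => _ [z _ <-].
by have [t tpi <-] := expi_surj z; exact: cmax.
Unshelve. all: by end_near. Qed.

Lemma le_sup_norm f z : normc (f z) <= sup_norm f.
Proof. by apply: (ub_le_sup (CT_bounded f)); exists z. Qed.

Lemma sup_norm_le f M : (forall z, normc (f z) <= M) -> sup_norm f <= M.
Proof.
move=> fM; apply: ge_sup; first by exists (normc (f (expi 0))), (expi 0).
by move=> _ [z _ <-].
Qed.

Lemma sup_normD f g : sup_norm (f + g) <= sup_norm f + sup_norm g.
Proof.
apply: sup_norm_le => z.
by rewrite (le_trans (@le_normcD R (f z) (g z)))// lerD// le_sup_norm.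
Qed.

Lemma normc_real a : normc a%:C = `|a|.
Proof. by rewrite /= expr0n/= addr0 sqrtr_sqr. Qed.

Lemma sup_normZ a f : sup_norm (a *: f) = `|a| * sup_norm f.
Proof.
have le_normZ b g : sup_norm (b *: g) <= `|b| * sup_norm g.
  apply: sup_norm_le => z.
  by rewrite [(b *: g) z]/(b%:C * g z) normcM normc_real ler_wpM2l// le_sup_norm.
have [->|a0] := eqVneq a 0.
  rewrite scale0r normr0 mul0r; apply/eqP; rewrite eq_le; apply/andP; split.
    by apply: sup_norm_le => z; rewrite normc0.
  by rewrite -(@normc0 R); exact: (@le_sup_norm 0 (expi 0)).
apply/eqP; rewrite eq_le le_normZ/= -ler_pdivlMl ?normr_gt0// -normfV.
by have := le_normZ a^-1 (a *: f); rewrite scalerA mulVf// scale1r.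
Qed.

Lemma sup_norm0_eq0 f : sup_norm f = 0 -> f = 0.
Proof.
move=> f0; apply: CT_ext => z; apply: eq0_normc.
by apply/eqP; rewrite eq_le -{1}f0 le_sup_norm -lecR -normcE normr_ge0.
Qed.

HB.instance Definition _ := Lmodule_isNormed.Build R (CT R)
  sup_normD sup_normZ sup_norm0_eq0.

Lemma CT_normE f : `|f| = sup (range (fun z => normc (f z))).
Proof. by []. Qed.

End ContinuousFunctions.

Section Averages.
Variable R : realType.
Implicit Types (f : CT R) (a : circle R) (n : nat).

(* The normalized Lebesgue measure of the circle is the image of Lebesgue
   measure on [0, 1] under t |-> exp (2 pi i t). *)
Definition circle_integral f : R[i] :=
  (\int[lebesgue_measure]_(t in `[0, 1]) complex.Re (f (expi (pi *+ 2 * t)))) +i*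
  (\int[lebesgue_measure]_(t in `[0, 1]) complex.Im (f (expi (pi *+ 2 * t)))).

Definition mean_zero : set (CT R) := [set f | circle_integral f = 0].

Lemma ergodic_mean_subproof a n f : continuous (fun z : circle R =>
  (n%:R^-1 * \sum_(1 <= j < n.+1) f (rotation a j z) : R[i]^o)).
Proof.
move=> z; apply: (@cvgZl_tmp R[i] R[i]^o _ _ (nbhs_filter z) n%:R^-1
  (fun z => \sum_(1 <= j < n.+1) f (rotation a j z))).
apply: (@cvg_big R[i]^o nat +%R 0 xpredT (@add_continuous R[i]^o) _ _ _
  (fun j z => f (rotation a j z)) (fun j => f (rotation a j z))) => j _.
exact: continuous_comp (@rotation_continuous R a j z) (@CT_continuous R f _).
Qed.

Definition ergodic_mean a n f : CT R := CTof (@ergodic_mean_subproof a n f).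

End Averages.
Arguments mean_zero : clear implicits.

(* Terms are indexed from 0, so [s] is a permutation of all of [nat]. *)
Definition unconditionally_convergent (K : numFieldType) (V : normedModType K)
    (u : V^nat) :=
  forall s : nat -> nat, bijective s -> cvgn (series (u \o s)).

(* Main.v *)
Require Import Defs.
From HB Require Import structures.
From mathcomp Require Import all_boot all_order all_algebra.
From mathcomp Require Import all_classical all_reals all_analysis.
From mathcomp Require Import borel_hierarchy complex.
From mathcomp Require Import ring lra.

(** The series fails to converge already in its natural order, because its
    partial sums [S_N f], the sums of the first [N] means, are unbounded for a
    generic mean-zero [f].

    The operators [S_N] are bounded, but their norms on mean-zero functions tend
    to infinity, for the following reason. The value of [S_N f] at 1 only involves
    [f] at finitely many points [a ^+ j], so a mean-zero function of norm 1 that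
    is close to 1 at all these points has [S_N f] close to [N] there. Such a
    function is given by a monomial [z ^ m] with [m > 0]: by recurrence of
    rotations ([circle_recurrence]), [m] can be chosen with [a ^+ m] as close to 1
    as desired, and then [a ^+ (j * m)] is close to 1 for all the finitely many
    [j] ([ex_monomial_mean_sum_ge]).

    By the uniform boundedness principle there is a mean-zero [g] whose partial
    sums are unbounded ([ex_unbounded_means]). To apply it on the Banach space of
    all continuous functions, whose completeness is [CT_complete], one composes
    [S_N] with the subtraction of the mean.

    The set of mean-zero [f] with unbounded [S_N f] is a countable intersection
    of open sets since each [S_N] is continuous. It is dense because its
    complement is a linear subspace that omits [g]: for every [f], either [f] or
    [f + e g] has unbounded partial sums ([unbounded_meansD]). A convergent series
    has bounded partial sums, hence no such [f] gives a convergent series. *)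

Set Implicit Arguments.
Unset Strict Implicit.
Unset Printing Implicit Defensive.
Import Order.TTheory GRing.Theory Num.Theory.
Import numFieldNormedType.Exports.
Import ComplexField.Normc.
Local Open Scope classical_set_scope.
Local Open Scope ring_scope.
Local Open Scope complex_scope.

(** * The modulus of a complex number *)

Section Modulus.
Variable R : realType.
Implicit Types w : R[i].

Lemma ReB : {morph @complex.Re R : u v / u - v}.
Proof. by move=> [? ?] [? ?]. Qed.

Lemma ImB : {morph @complex.Im R : u v / u - v}.
Proof. by move=> [? ?] [? ?]. Qed.

Lemma normrRe_le w : `|complex.Re w| <= normc w.
Proof. by case: w => x y /=; rewrite -sqrtr_sqr ler_wsqrtr// lerDl sqr_ge0. Qed.

Lemma normrIm_le w : `|complex.Im w| <= normc w.
Proof. by case: w => x y /=; rewrite -sqrtr_sqr ler_wsqrtr// lerDr sqr_ge0. Qed.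

Lemma normc_ge0 w : 0 <= normc w.
Proof. exact: le_trans (normr_ge0 _) (normrRe_le w). Qed.

Lemma normc_le w : normc w <= `|complex.Re w| + `|complex.Im w|.
Proof.
case: w => x y /=; rewrite -[leRHS]ger0_norm ?addr_ge0//.
rewrite -sqrtr_sqr ler_wsqrtr// sqrrD !real_normK ?num_real//.
by rewrite -addrA lerD2l lerDr mulrn_wge0// mulr_ge0.
Qed.

Lemma ler_normcD w1 w2 : normc (w1 + w2) <= normc w1 + normc w2.
Proof. exact: (@le_normcD R w1 w2). Qed.

Lemma normc_nat m : normc (m%:R : R[i]) = m%:R.
Proof. by rewrite -(rmorph_nat (real_complex R)) normc_real ger0_norm. Qed.

Lemma normc_distC w1 w2 : normc (w1 - w2) = normc (w2 - w1).
Proof. by rewrite -(@normcN R (w1 - w2)) opprB. Qed.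

Lemma normc_sum (I : Type) (r : seq I) (P : pred I) (F : I -> R[i]) :
  normc (\sum_(i <- r | P i) F i) <= \sum_(i <- r | P i) normc (F i).
Proof.
elim/big_ind2 : _ => [|x1 x2 y1 y2 h1 h2|//]; first by rewrite normc0.
by rewrite (le_trans (ler_normcD _ _))// lerD.
Qed.

(** The norm of [R[i]^o] takes its values in [R[i]], where the order is partial;
    this turns continuity into estimates between real numbers. *)
Lemma continuous_normcP (T : topologicalType) (f : T -> R[i]^o) :
  continuous f <->
  forall x (e : R), 0 < e -> \forall y \near x, normc (f x - f y) < e.
Proof.
split=> [cf x e e0|cf x].
  have e0' : (0 : R[i]) < e%:C by rewrite ltcR.
  near=> y.
  rewrite -ltcR -Defs.normcE.
  by near: y; exact: cvgr_dist_lt _ _ (cf x) _ e0'.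
apply/cvgrPdist_lt => /= e; case: e => e e' /andP[/= /eqP -> e0].
near=> y; rewrite Defs.normcE ltcR.
by near: y; exact: cf.
Unshelve. all: by end_near. Qed.

End Modulus.

(** * Completeness of the space of continuous functions *)

Section Completeness.
Variable R : realType.
Implicit Types f : CT R.

Lemma normCT_le f (M : R) : (forall z, normc (f z) <= M) -> `|f| <= M.
Proof. exact: sup_norm_le. Qed.

Lemma normc_le_norm f z : normc (f z) <= `|f|.
Proof. exact: le_sup_norm. Qed.

(** The limit is built pointwise, from the real and imaginary parts. The bound
    that makes a function of the filter uniformly close to the limit is first
    obtained at each point with an arbitrarily small loss, so it is uniform;
    continuity of the limit and convergence in norm both follow from it. *)
Lemma CT_complete (F : set_system (CT R)) : ProperFilter F -> cauchy F -> cvg F.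
Proof.
move=> FF /cauchyP Fc.
have Fb (e : R) : 0 < e -> exists f0 : CT R, \forall f \near F, `|f0 - f| < e.
  exact: Fc.
have ptc (p : R[i] -> R) : (forall w, `|p w| <= normc w) ->
    {morph p : u v / u - v} ->
    forall z, cvg ((fun f : CT R => p (f z)) @ F).
  move=> ple pB z; apply/cauchy_cvgP/cauchy_exP => e e0.
  have [f0 f0F] := Fb e e0.
  exists (p (f0 z)); apply: filterS f0F => f f0f.
  rewrite /ball/= -pB (le_lt_trans (ple _))//.
  by apply: le_lt_trans f0f; exact: (normc_le_norm (f0 - f)).
have Rec := ptc (@complex.Re R) (@normrRe_le R) (@ReB R).
have Imc := ptc (@complex.Im R) (@normrIm_le R) (@ImB R).
pose g (z : circle R) : R[i]^o :=
  lim ((fun f : CT R => complex.Re (f z)) @ F) +i*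
  lim ((fun f : CT R => complex.Im (f z)) @ F).
have gle (e : R) f0 : (\forall f \near F, `|f0 - f| < e) ->
    forall z, normc (g z - f0 z) <= e.
  move=> f0F z; apply/ler_addgt0Pr => d d0.
  near F => f.
  have -> : g z - f0 z = (g z - f z) + (f z - f0 z) by rewrite addrA subrK.
  rewrite addrC (le_trans (ler_normcD _ _))// lerD//.
    rewrite (le_trans (normc_le_norm (f - f0) z))// distrC ltW//.
    by near: f.
  rewrite (le_trans (normc_le _))// [d]splitr lerD//.
  - rewrite ReB ltW//; near: f.
    by apply: cvgr_dist_lt (Rec z) _ _; rewrite divr_gt0.
  - rewrite ImB ltW//; near: f.
    by apply: cvgr_dist_lt (Imc z) _ _; rewrite divr_gt0.
have gc : continuous g.
  apply/continuous_normcP => z e e0.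
  have e30 : 0 < e / 3 by lra.
  have [f0 /gle f0g] := Fb _ e30.
  have /continuous_normcP/(_ z _ e30) f0c := @CT_continuous R f0.
  near=> w.
  have -> : g z - g w = (g z - f0 z) + ((f0 z - f0 w) + (f0 w - g w)).
    by rewrite !addrA !subrK.
  have : normc (f0 z - f0 w) < e / 3 by near: w.
  have := f0g z; have := f0g w; rewrite normc_distC.
  have := ler_normcD (g z - f0 z) ((f0 z - f0 w) + (f0 w - g w)).
  have := ler_normcD (f0 z - f0 w) (f0 w - g w).
  lra.
apply/cvg_ex; exists (CTof gc).
apply/cvgrPdist_le => e e0.
have [f0 f0F] : exists f0 : CT R, \forall f \near F, `|f0 - f| < e / 2.
  by apply: Fb; lra.
near=> f.
have -> : CTof gc - f = (CTof gc - f0) + (f0 - f) by rewrite addrA subrK.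
rewrite (le_trans (ler_normD _ _))// [e]splitr lerD//.
  by apply: normCT_le => z; exact: (gle _ _ f0F).
by rewrite ltW//; near: f.
Unshelve. all: by end_near. Qed.

HB.instance Definition _ := Uniform_isComplete.Build (CT R) CT_complete.

End Completeness.

(** * The mean of a function and its subtraction *)

Section CircleIntegral.
Variable R : realType.
Implicit Types (f : CT R) (c : R[i]).

Lemma continuous_expi2pi : continuous (fun t : R => expi (pi *+ 2 * t)).
Proof.
move=> t; apply: continuous_comp; last exact: expi_continuous.
exact: mulrl_continuous.
Qed.

Lemma integrable_comp_circle (p : R[i] -> R) f :
  (forall u v, `|p u - p v| <= normc (u - v)) ->
  (@lebesgue_measure R).-integrable `[0, 1]
    (EFin \o (fun t => p (f (expi (pi *+ 2 * t))))).
Proof.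
move=> pL; apply: continuous_compact_integrable; first exact: segment_compact.
apply: continuous_subspaceT => t.
apply/cvgrPdist_lt => e e0.
have /continuous_normcP/(_ _ e e0) cf := @CT_continuous R f.
near=> s; apply: le_lt_trans (pL _ _) _; near: s.
exact: (@continuous_expi2pi t _ (cf _)).
Unshelve. all: by end_near. Qed.

Lemma integrable_Re f : (@lebesgue_measure R).-integrable `[0, 1]
  (EFin \o (fun t => complex.Re (f (expi (pi *+ 2 * t))))).
Proof.
by apply: integrable_comp_circle => u v; rewrite -ReB; exact: normrRe_le.
Qed.

Lemma integrable_Im f : (@lebesgue_measure R).-integrable `[0, 1]
  (EFin \o (fun t => complex.Im (f (expi (pi *+ 2 * t))))).
Proof.
by apply: integrable_comp_circle => u v; rewrite -ImB; exact: normrIm_le.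
Qed.

Lemma Rintegral01_cst (r : R) :
  \int[lebesgue_measure]_(t in `[(0 : R), 1]) r = r.
Proof.
rewrite Rintegral_cst// [X in fine X](_ : _ = 1%E) ?mulr1//.
transitivity (@lebesgue_measure R [set` `[0, 1]]) => //.
by rewrite lebesgue_measure_itv/= lte_fin ltr01 oppr0 adde0.
Qed.

Lemma circle_integralP (a : R) f g :
  circle_integral (a *: f + g) =
  a%:C * circle_integral f + circle_integral g.
Proof.
have ReE t : complex.Re ((a *: f + g) t) =
    a * complex.Re (f t) + complex.Re (g t).
  rewrite -[(a *: f + g) t]/(a%:C * f t + g t).
  by case: (f t) (g t) => [? ?] [? ?]/=; rewrite mul0r subr0.
have ImE t : complex.Im ((a *: f + g) t) =
    a * complex.Im (f t) + complex.Im (g t).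
  rewrite -[(a *: f + g) t]/(a%:C * f t + g t).
  by case: (f t) (g t) => [? ?] [? ?]/=; rewrite mul0r addr0.
have lin (p q : R -> R) :
    (@lebesgue_measure R).-integrable `[0, 1] (EFin \o p) ->
    (@lebesgue_measure R).-integrable `[0, 1] (EFin \o q) ->
    \int[lebesgue_measure]_(t in `[0, 1]) (a * p t + q t) =
    a * \int[lebesgue_measure]_(t in `[0, 1]) p t +
    \int[lebesgue_measure]_(t in `[0, 1]) q t.
  move=> ip iq; rewrite RintegralD//; first by rewrite RintegralZl.
  exact: integrableZl ip.
rewrite /circle_integral; apply/eqP.
rewrite eq_complex/= !(mul0r, addr0, subr0).
under eq_Rintegral do rewrite ReE.
under [X in _ && (X == _)]eq_Rintegral do rewrite ImE.
rewrite !lin//; first [exact: integrable_Re | exact: integrable_Im | idtac].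
by rewrite !eqxx.
Qed.

(** The factor 2 comes from treating the real and imaginary parts separately;
    any constant would serve to make the subtraction of the mean bounded. *)
Lemma normc_circle_integral_le f : normc (circle_integral f) <= `|f| *+ 2.
Proof.
have le p : (forall w, `|p w| <= normc w) ->
    (@lebesgue_measure R).-integrable `[0, 1]
      (EFin \o (fun t => p (f (expi (pi *+ 2 * t))))) ->
    `|\int[lebesgue_measure]_(t in `[0, 1]) p (f (expi (pi *+ 2 * t)))| <= `|f|.
  move=> ple ip; apply: le_trans (le_normr_Rintegral _ _) _ => //.
  have -> : `|f| = \int[lebesgue_measure]_(t in `[(0 : R), 1]) `|f|.
    by rewrite Rintegral01_cst.
  apply: le_Rintegral => //=.
  - exact: integrable_norm ip.
  - apply: continuous_compact_integrable; first exact: segment_compact.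
    by apply: continuous_subspaceT => t; exact: cvg_cst.
  - by move=> t _; rewrite (le_trans (ple _))// normc_le_norm.
rewrite (le_trans (normc_le _))// mulr2n lerD//.
- by apply: le; [exact: normrRe_le|exact: integrable_Re].
- by apply: le; [exact: normrIm_le|exact: integrable_Im].
Qed.

Definition CTcst c : CT R := CTof (@cts_fun _ _ (cst (c : R[i]^o))).

Lemma circle_integral_cst c : circle_integral (CTcst c) = c.
Proof.
by rewrite /circle_integral/= !Rintegral01_cst; case: c.
Qed.

(** A bounded linear projection onto the mean-zero functions. Precomposing with
    it lets one apply the uniform boundedness principle on the whole Banach
    space and still obtain a mean-zero function. *)
Definition subtract_mean f : CT R := f - CTcst (circle_integral f).

Lemma mean_zero_subtract_mean f : mean_zero R (subtract_mean f).
Proof.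
rewrite /mean_zero/= /subtract_mean addrC -scaleN1r.
by rewrite circle_integralP circle_integral_cst rmorphN1 mulN1r addNr.
Qed.

Lemma subtract_mean_id f : mean_zero R f -> subtract_mean f = f.
Proof.
rewrite /mean_zero/= /subtract_mean => ->; apply/CT_ext => z.
exact: subr0.
Qed.

Lemma subtract_mean_linear : linear subtract_mean.
Proof.
move=> a f g; apply: CT_ext => z; rewrite /subtract_mean.
rewrite -[LHS]/((a%:C * f z + g z) - circle_integral (a *: f + g)).
rewrite -[RHS]/(a%:C * (f z - circle_integral f) + (g z - circle_integral g)).
by rewrite circle_integralP; ring.
Qed.

Lemma norm_subtract_mean_le f : `|subtract_mean f| <= 3 * `|f|.
Proof.
apply: normCT_le => z.
rewrite -[subtract_mean f z]/(f z - circle_integral f).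
rewrite (le_trans (ler_normcD _ _))// (@normcN R (circle_integral f)).
have := normc_le_norm f z; have := normc_circle_integral_le f; lra.
Qed.

End CircleIntegral.

(** * The functions z ^ m *)

Section Monomials.
Variable R : realType.
Implicit Types (z : circle R) (m : nat).

Lemma normc_circle z : normc (val z : R[i]) = 1.
Proof.
have : `|val z : R[i]| = 1 by exact: set_valP z.
by rewrite Defs.normcE => -[].
Qed.

Lemma normcX (w : R[i]) m : normc (w ^+ m) = normc w ^+ m.
Proof.
by elim: m => [|m IHm]; rewrite ?expr0 ?normc1// !exprS normcM IHm.
Qed.

(** Used with [v = 1] as well: if [u] is within [d] of 1, then its first [m]
    powers are within [m * d] of 1. *)
Lemma normc_exprB m (u v : R[i]) : normc u = 1 -> normc v = 1 ->
  normc (u ^+ m - v ^+ m) <= m%:R * normc (u - v).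
Proof.
move=> u1 v1; elim: m => [|m IHm]; first by rewrite !expr0 subrr normc0 mul0r.
have -> : u ^+ m.+1 - v ^+ m.+1 = u * (u ^+ m - v ^+ m) + (u - v) * v ^+ m.
  by rewrite !exprS; ring.
rewrite (le_trans (ler_normcD _ _))// !normcM normcX u1 v1 expr1n mul1r mulr1.
by rewrite -natr1 mulrDl mul1r lerD.
Qed.

Lemma monomial_subproof m :
  continuous (fun z : circle R => val z ^+ m : R[i]^o).
Proof.
have vc : continuous (fun z : circle R => val z : R[i]^o).
  exact: initial_continuous.
apply/continuous_normcP => z e e0.
have e'0 : 0 < e / m.+1%:R by rewrite divr_gt0.
near=> w.
rewrite (le_lt_trans (normc_exprB m (normc_circle z) (normc_circle w)))//.
have : normc ((val z : R[i]^o) - val w) < e / m.+1%:R.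
  by near: w; move/continuous_normcP : vc => /(_ z); exact.
rewrite ltr_pdivlMr// mulrC => /(le_lt_trans _); apply.
by rewrite ler_wpM2r// ?ler_nat// normc_ge0.
Unshelve. all: by end_near. Qed.

Definition monomial m : CT R := CTof (@monomial_subproof m).

Lemma norm_monomial_le m : `|monomial m| <= 1.
Proof.
by apply: normCT_le => z; rewrite /= normcX normc_circle expr1n.
Qed.

Lemma expiX (t : R) m :
  (val (expi t) : R[i]) ^+ m = cos (m%:R * t) +i* sin (m%:R * t).
Proof.
elim: m => [|m IHm]; first by rewrite expr0 mul0r cos0 sin0.
rewrite exprS IHm /= -natr1 mulrDl mul1r cosD sinD.
by apply/eqP; rewrite eq_complex/=; apply/andP; split; apply/eqP; ring.
Qed.

Lemma cos_sin_2pi m :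
  cos (m%:R * (pi *+ 2)) = 1 :> R /\ sin (m%:R * (pi *+ 2)) = 0 :> R.
Proof.
elim: m => [|m [cm sm]]; first by rewrite mul0r cos0 sin0.
rewrite -natr1 mulrDl mul1r (cosD _ (pi *+ 2)) (sinD _ (pi *+ 2)).
by rewrite cm sm cos2pi sin2pi; split; ring.
Qed.

(** The real and imaginary parts of the monomial along the parametrization of
    the circle are [cos (w t)] and [sin (w t)] with [w = 2 pi m]; their
    primitives take the same value at 0 and 1. *)
Lemma mean_zero_monomial m : (0 < m)%N -> mean_zero R (monomial m).
Proof.
move=> m0; pose w : R := m%:R * (pi *+ 2).
have w0 : w != 0.
  by rewrite mulf_neq0 ?pnatr_eq0 ?lt0n_neq0// mulrn_eq0/= gt_eqF// pi_gt0.
have mE t :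
    (monomial m (expi (pi *+ 2 * t)) : R[i]) = cos (w * t) +i* sin (w * t).
  by have := expiX (pi *+ 2 * t) m; rewrite mulrA.
have [c1 s1] := cos_sin_2pi m; rewrite -/w in c1 s1.
have FTC (f F : R -> R) : continuous f ->
    (forall t : R, is_derive t (1 : R) F (f t)) ->
    \int[lebesgue_measure]_(t in `[0, 1]) f t = F 1 - F 0.
  move=> cf dF; rewrite /Rintegral (@continuous_FTC2 R f F)//.
  - exact: continuous_subspaceT.
  - have cF : continuous F.
      by move=> t; apply: differentiable_continuous; apply/derivable1_diffP.
    split; first by move=> t _; exact: ex_derive.
    + by apply: cvg_at_right_filter; exact: cF.
    + by apply: cvg_at_left_filter; exact: cF.
  - by move=> t _; rewrite derive1E; exact: derive_val.
have cw : continuous (fun t : R => w * t) by exact: mulrl_continuous.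
have ccos : continuous (fun t : R => cos (w * t)).
  by move=> t; apply: continuous_comp; [exact: cw|exact: continuous_cos].
have csin : continuous (fun t : R => sin (w * t)).
  by move=> t; apply: continuous_comp; [exact: cw|exact: continuous_sin].
have dsin (t : R) :
    is_derive t (1 : R) (fun t => w^-1 * sin (w * t)) (cos (w * t)).
  by apply: is_derive_eq; rewrite /GRing.scale/=; field.
have dcos (t : R) :
    is_derive t (1 : R) (fun t => - w^-1 * cos (w * t)) (sin (w * t)).
  by apply: is_derive_eq; rewrite /GRing.scale/=; field.
rewrite /mean_zero/= /circle_integral.
under eq_Rintegral do rewrite mE/=.
under [X in _ +i* X]eq_Rintegral do rewrite mE/=.
rewrite (FTC _ _ ccos dsin) (FTC _ _ csin dcos).
by rewrite mulr1 mulr0 cos0 sin0 c1 s1 !subrr.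
Qed.

End Monomials.

(** * Recurrence of rotations *)

Section Recurrence.
Variable R : realType.

(** Pigeonhole: cut the square containing the circle into finitely many cells
    of side [1 / K]. Two of the powers of [z], say the [k]-th and the [l]-th with
    [k < l], lie in the same cell, and multiplying by the [k]-th power is an
    isometry, so the power [l - k] is within [2 / K] of 1. *)
Lemma circle_recurrence (z : circle R) (e : R) : 0 < e ->
  exists2 m, (0 < m)%N & normc ((val z : R[i]) ^+ m - 1) < e.
Proof.
move=> e0; pose K := (Num.trunc (2 / e)).+1.
have Ke : 2 < e * K%:R.
  rewrite -ltr_pdivrMl// mulrC /K.
  by have /truncn_itv/andP[] : 0 <= 2 / e by rewrite divr_ge0 ?ltW.
(* For x in [-1, 1] the truncation is at most 2 K, so inord does not alter it. *)
pose cell (x : R) : 'I_(K.*2).+1 := inord (Num.trunc ((x + 1) * K%:R)).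
have cell_close x y : `|x| <= 1 -> `|y| <= 1 -> cell x = cell y ->
    `|x - y| * K%:R < 1.
  have tr u : `|u| <= 1 ->
      (Num.trunc ((u + 1) * K%:R))%:R <= (u + 1) * K%:R <
        (Num.trunc ((u + 1) * K%:R)).+1%:R /\
      val (cell u) = Num.trunc ((u + 1) * K%:R).
    rewrite ler_norml => /andP[u1 u2].
    have u0 : 0 <= (u + 1) * K%:R by rewrite mulr_ge0//; lra.
    split; first exact: truncn_itv.
    rewrite /= inordK// ltnS -(@ler_nat R).
    rewrite (@le_trans _ _ ((u + 1) * K%:R)) ?truncn_le//.
    by rewrite -muln2 natrM mulrC ler_wpM2l//; lra.
  move=> /tr[/andP[x1 x2] vx] /tr[/andP[y1 y2] vy] /(congr1 val).
  rewrite vx vy => xy; rewrite -xy -natr1 in y1 y2; rewrite -natr1 in x2.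
  rewrite -[K%:R]ger0_norm// -normrM ltr_norml; apply/andP; split; lra.
pose T := ('I_(K.*2).+1 * 'I_(K.*2).+1)%type.
pose h (k : 'I_(#|{: T}|).+1) : T :=
  (cell (complex.Re ((val z : R[i]) ^+ k)),
   cell (complex.Im ((val z : R[i]) ^+ k))).
have /injectivePn[k [l kl hkl]] : ~~ injectiveb h.
  by apply/injectiveP => /leq_card; rewrite card_ord ltnn.
wlog ltkl : k l kl hkl / (k < l)%N.
  move=> wl; have := kl; rewrite -val_eqE neq_ltn => /orP[|] ltkl.
    exact: (wl k l).
  by apply: (wl l k) => //; rewrite eq_sym.
have zX1 j : normc ((val z : R[i]) ^+ j) = 1.
  by rewrite normcX normc_circle expr1n.
have Xle (p : R[i] -> R) j : (forall w, `|p w| <= normc w) ->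
  `|p ((val z : R[i]) ^+ j)| <= 1 by rewrite -(zX1 j).
exists (l - k)%N; first by rewrite subn_gt0.
have -> : normc ((val z : R[i]) ^+ (l - k) - 1) =
    normc ((val z : R[i]) ^+ l - (val z : R[i]) ^+ k).
  rewrite -[in RHS](subnK (ltnW ltkl)) exprD.
  rewrite -[X in _ = normc (_ - X)]mul1r -mulrBl.
  by rewrite normcM zX1 mulr1.
case: hkl => /esym/cell_close hRe /esym/cell_close hIm.
rewrite (le_lt_trans (normc_le _))// ReB ImB -(@ltr_pM2r _ K%:R) ?ltr0n//.
have := hRe (Xle _ _ (@normrRe_le R)) (Xle _ _ (@normrRe_le R)).
have := hIm (Xle _ _ (@normrIm_le R)) (Xle _ _ (@normrIm_le R)).
rewrite mulrDl; lra.
Qed.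

End Recurrence.

(** * Ergodic means and their partial sums *)

Section Means.
Variables (R : realType) (a : circle R).
Implicit Types (f g : CT R) (n : nat).

(** A disc is convex. With [c = 0] this bounds the means by the norm of the
    function; with [c = 1] it shows that the mean of values close to 1 is close
    to 1. *)
Lemma normc_mean_sub (F : nat -> R[i]) (c : R[i]) (d : R) n : (0 < n)%N ->
  (forall j, (1 <= j <= n)%N -> normc (F j - c) <= d) ->
  normc (n%:R^-1 * \sum_(1 <= j < n.+1) F j - c) <= d.
Proof.
move=> n0 Fd.
have nC : (n%:R : R[i]) != 0 by rewrite pnatr_eq0 lt0n_neq0.
have -> : n%:R^-1 * \sum_(1 <= j < n.+1) F j - c =
    n%:R^-1 * \sum_(1 <= j < n.+1) (F j - c).
  rewrite big_split/= mulrDr sumr_const_nat subSS subn0.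
  by rewrite -(mulr_natl (- c)) mulrA mulVf// mul1r.
rewrite normcM normcV normc_nat ler_pdivrMl ?ltr0n//.
rewrite (le_trans (normc_sum _ _ _))//.
rewrite big_nat (le_trans (ler_sum _ (fun j => Fd j)))//.
by rewrite -big_nat sumr_const_nat subSS subn0 mulr_natl.
Qed.

Lemma ergodic_mean_linear n : linear (ergodic_mean a n).
Proof.
move=> k f g; apply: CT_ext => z.
rewrite -[LHS]/(n%:R^-1 * \sum_(1 <= j < n.+1)
  (k%:C * f (rotation a j z) + g (rotation a j z))).
rewrite -[RHS]/(k%:C * (n%:R^-1 * \sum_(1 <= j < n.+1) f (rotation a j z)) +
  n%:R^-1 * \sum_(1 <= j < n.+1) g (rotation a j z)).
by rewrite big_split/= -mulr_sumr mulrDr mulrCA.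
Qed.

Lemma norm_ergodic_mean_le n f : (0 < n)%N -> `|ergodic_mean a n f| <= `|f|.
Proof.
move=> n0; apply: normCT_le => z.
rewrite -[ergodic_mean a n f z]subr0.
by apply: normc_mean_sub => // j _; rewrite subr0; exact: normc_le_norm.
Qed.

End Means.

Section PartialSums.
Variables (R : realType) (a : circle R) (n : nat -> nat).
Hypothesis n_gt0 : forall k, (0 < n k)%N.

Definition mean_sum N (f : CT R) : CT R :=
  series (fun k => ergodic_mean a (n k) f) N.

Lemma mean_sum_linear N : linear (mean_sum N).
Proof.
move=> k f g; rewrite /mean_sum /series/= scaler_sumr -big_split/=.
by apply: eq_bigr => i _; exact: ergodic_mean_linear.
Qed.

Lemma norm_mean_sum_le N f : `|mean_sum N f| <= N%:R * `|f|.
Proof.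
rewrite /mean_sum /series/= (le_trans (ler_norm_sum _ _ _))//.
have le k := norm_ergodic_mean_le a f (n_gt0 k).
rewrite (le_trans (ler_sum _ (fun k _ => le k)))//.
by rewrite sumr_const_nat subn0 mulr_natl.
Qed.

Lemma mean_sumE N f z :
  mean_sum N f z = \sum_(0 <= k < N) ergodic_mean a (n k) f z.
Proof. by rewrite /mean_sum /series/=; elim/big_rec2 : _ => // i u v _ <-. Qed.

(** Choose [m] such that [a ^+ m] is so close to 1 that its powers of exponent
    at most [n k], for all [k < N], are within 1/2 of 1. These powers are the
    values of the monomial on the orbit of 1 that enter the first [N] means, so
    each of these means is within 1/2 of 1 at the point 1. *)
Lemma ex_monomial_mean_sum_ge N :
  exists2 m, (0 < m)%N & N%:R / 2 <= `|mean_sum N (monomial R m)|.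
Proof.
(* Any common upper bound of the n k with k < N would do. *)
pose L : nat := (\sum_(0 <= k < N) n k)%N.
have L0 : 0 < (L.+1)%:R :> R by rewrite ltr0n.
have L20 : 0 < (L.+1)%:R^-1 / 2 :> R by rewrite divr_gt0// invr_gt0.
have [m m0 am] := circle_recurrence a L20.
exists m => //.
have near1 k : (k < N)%N ->
    normc (ergodic_mean a (n k) (monomial R m) (expi 0) - 1) <= 2^-1.
  move=> kN; apply: normc_mean_sub => // j /andP[_ jn].
  have -> : monomial R m (rotation a j (expi 0)) = ((val a : R[i]) ^+ m) ^+ j.
    transitivity
      (((val a : R[i]) ^+ j * (cos (0 : R) +i* sin (0 : R))) ^+ m) => //.
    by rewrite cos0 sin0 mulr1 exprAC.
  rewrite -[X in normc (_ - X)](expr1n _ j).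
  rewrite (le_trans (normc_exprB _ _ _))//.
  - by rewrite normcX normc_circle expr1n.
  - exact: normc1.
  have jL : j%:R <= L.+1%:R :> R.
    rewrite ler_nat (leq_trans jn)// leqW// /L (bigD1_seq k) ?iota_uniq//=.
      by rewrite leq_addr.
    by rewrite mem_index_iota.
  rewrite (le_trans (ler_wpM2r _ jL))//; first by exact: normc_ge0.
  by rewrite -ler_pdivlMl// ltW.
apply: le_trans (normc_le_norm _ (expi 0)).
rewrite mean_sumE; set s := \sum_(_ <= _ < _) _.
have sN : normc (s - N%:R) <= N%:R / 2.
  have -> : s - N%:R = \sum_(0 <= k < N)
      (ergodic_mean a (n k) (monomial R m) (expi 0) - 1).
    by rewrite big_split/= sumrN sumr_const_nat subn0.
  rewrite (le_trans (normc_sum _ _ _))// big_nat.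
  rewrite (le_trans (ler_sum _ (fun k => near1 k)))//.
  by rewrite -big_nat sumr_const_nat subn0 mulr_natl.
have := ler_normcD (N%:R - s) s; rewrite subrK normc_distC normc_nat; lra.
Qed.

End PartialSums.

(** * Functions with unbounded partial sums *)

Section Resonance.
Variables (R : realType) (a : circle R) (n : nat -> nat).
Hypothesis n_gt0 : forall k, (0 < n k)%N.

Definition unbounded_means : set (CT R) :=
  [set f | forall M : R, exists N, M < `|mean_sum a n N f|].

(** Uniform boundedness principle. The operators [mean_sum a n N] have norm at
    least [N / 2] on mean-zero functions, by the monomials, so they cannot be
    pointwise bounded there. *)
Lemma ex_unbounded_means : exists2 f, mean_zero R f & unbounded_means f.
Proof.
apply: contrapT => noB.
pose T : set (CT R -> CT R) :=
  range (fun N => mean_sum a n N \o @subtract_mean R).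
have [||M TM] := @Banach_Steinhauss R (CT R) (CT R) T _ _ 1.
- move=> _ [N _ <-]; split.
    move=> r; exists (N%:R * (3 * r)) => f fr.
    rewrite (le_trans (norm_mean_sum_le _ n_gt0 _ _))// ler_wpM2l//.
    by rewrite (le_trans (norm_subtract_mean_le _))// ler_wpM2l.
  by move=> k f g /=; rewrite subtract_mean_linear mean_sum_linear.
- move=> f; have /existsNP[M NM] : ~ unbounded_means (subtract_mean f).
    move=> Bf; apply: noB; exists (subtract_mean f) => //.
    exact: mean_zero_subtract_mean.
  exists M => _ [N _ <-] /=; rewrite leNgt; apply/negP => MN.
  by apply: NM; exists N.
pose N := (Num.trunc (`|M| * 2)).+1.
have [m m0 Nm] := ex_monomial_mean_sum_ge a n_gt0 N.
have := TM _ (ex_intro2 _ _ N I erefl) _ (norm_monomial_le R m).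
rewrite /= subtract_mean_id; last exact: mean_zero_monomial.
move=> /(le_trans Nm); rewrite ler_pdivrMr// leNgt => /negP; apply.
rewrite (@le_lt_trans _ _ (`|M| * 2)) ?ler_wpM2r ?ler_norm//.
by rewrite -truncn_lt_nat// mulr_ge0.
Qed.

(** The functions with bounded partial sums form a linear subspace: if [f] and
    [f + e *: g] were both in it, then so would be [g]. *)
Lemma unbounded_meansD f g (e : R) : e != 0 -> unbounded_means g ->
  unbounded_means f \/ unbounded_means (f + e *: g).
Proof.
move=> e0 Bg.
have [Bf|/existsNP[M fM]] := pselect (unbounded_means f); first by left.
right=> K; have [N gN] := Bg ((K + M) / `|e|); exists N.
have {}fM : `|mean_sum a n N f| <= M.
  by rewrite leNgt; apply/negP => MN; apply: fM; exists N.
rewrite addrC mean_sum_linear.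
have := ler_normB (e *: mean_sum a n N g + mean_sum a n N f) (mean_sum a n N f).
rewrite addrK normrZ.
by move: gN; rewrite ltr_pdivrMr ?normr_gt0// mulrC; lra.
Qed.

Lemma continuous_mean_sum N : continuous (mean_sum a n N).
Proof.
move=> f; apply/(@cvgrPdist_lt _ _ _ _ (nbhs_filter f)) => e e0; near=> g.
have -> : mean_sum a n N f - mean_sum a n N g = mean_sum a n N (f - g).
  by have := mean_sum_linear a n N (-1) g f; rewrite !scaleN1r ![- _ + _]addrC.
rewrite (le_lt_trans (norm_mean_sum_le _ n_gt0 _ _))//.
have : `|f - g| < e / N.+1%:R.
  near: g; apply/nbhs_normP; exists (e / N.+1%:R) => //=.
  by rewrite divr_gt0.
rewrite ltr_pdivlMr// mulrC => /(le_lt_trans _); apply.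
by rewrite ler_wpM2r// ler_nat.
Unshelve. all: by end_near. Qed.

End Resonance.

Theorem proposition7p2 (R : realType) (alpha : circle R)
  (alpha_irr : forall m : nat, (0 < m)%N -> val alpha ^+ m <> 1)
  (n : nat -> nat) (n_gt0 : forall k, (0 < n k)%N)
  (n_incr : forall k l, (k < l)%N -> (n k < n l)%N) :
  exists B : set (mean_zero R),
    [/\ Gdelta B, dense B &
      forall f : mean_zero R, B f ->
        ~ unconditionally_convergent
            (fun k => ergodic_mean alpha (n k) (val f))].
Proof.
have valc : continuous (val : mean_zero R -> CT R) by exact: initial_continuous.
exists [set f | unbounded_means alpha n (val f)]; split.
- exists (fun i : nat => \bigcup_N
    [set f : mean_zero R | i%:R < `|mean_sum alpha n N (val f)|]).
    move=> i; apply: bigcup_open => N _.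
    apply: (@open_comp _ _
      (fun f : mean_zero R => `|mean_sum alpha n N (val f)|)
      [set y | y > i%:R]); last exact: open_gt.
    move=> f _; apply: continuous_comp; last exact: norm_continuous.
    by apply: continuous_comp; [exact: valc|exact: continuous_mean_sum].
  apply/seteqP; split=> [f Bf i _|f Bf M]/=.
    by have [N iN] := Bf i%:R; exists N.
  have [N _ /= iN] := Bf (Num.trunc `|M|).+1 I.
  exists N; apply: lt_trans iN; rewrite (le_lt_trans (ler_norm M))//.
  by rewrite -truncn_lt_nat.
(* Either f0 itself has unbounded partial sums, or a small multiple of g can be
   added to it. *)
- move=> O [f0 Of0] [U oU UO].
  have [g g0 Bg] := ex_unbounded_means alpha n_gt0.
  have Uf0 : U (val f0) by move: Of0; rewrite -UO.
  have [e /= e0 eU] : exists2 e : R, 0 < e & ball (val f0) e `<=` U.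
    by have /nbhs_ballP := open_nbhs_nbhs (conj oU Uf0).
  pose d := e / (`|g| + 1).
  have g1 : 0 < `|g| + 1 by rewrite ltr_wpDl.
  have d0 : 0 < d by rewrite divr_gt0.
  have [Bf0|Bf1] := unbounded_meansD (val f0) (lt0r_neq0 d0) Bg.
    by exists f0; split.
  have f1P : val f0 + d *: g \in mean_zero R.
    apply/mem_set; rewrite /mean_zero/= addrC circle_integralP g0 mulr0 add0r.
    exact: set_valP f0.
  exists (SigSub f1P); split=> //.
  rewrite -UO; apply: eU; rewrite -ball_normE /ball_/=.
  rewrite opprD addrA subrr sub0r normrN normrZ gtr0_norm// /d.
  by rewrite mulrAC ltr_pdivrMr// ltr_pM2l// ltrDl.
- move=> f Bf uc; have /cvg_seq_bounded := uc id (Bijective (frefl _) (frefl _)).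
  move=> [M [_ /(_ (M + 1))]]; rewrite ltrDl ltr01 => /(_ isT) fM.
  have [N] := Bf (M + 1); apply/negP; rewrite -leNgt.
  exact: fM N I.
Qed.
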